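(* Consider the Friggstad–Gao instances $T_{FG}^h$, $h\ge2$, and let $k=k(h)$ be the number of requests of $T_{FG}^h$. (i) For every fixed integer $t\ge1$, the integrality gap of $P^t_{\operatorname{rank}}$ on these instances is $\Omega(\sqrt{\log k})$: there is $\alpha_t>0$ such that for all sufficiently large $h$ the gap on $T_{FG}^h$ is at least $\alpha_t\sqrt{\log k}$. (ii) For every $0<c\le 1$, the integrality gap of both $P^{k^c}$ and $P^{k^c}_{\operatorname{rank}}$ on these instances is $\Omega(1/c)$: there is an absolute constant $\alpha>0$ such that for every $0<c\le1$ there is $h_0(c)$ such that for all $h\ge h_0(c)$ both gaps on $T_{FG}^h$ are at least $\alpha/c$.
   Context: ANF-Tree: an instance consists of an undirected tree $(V,E)$ with edge capacities $u_e>0$ and a finite set $R$ of requests; each request $q\in R$ has endpoints $s_q\neq t_q$, demand $d_q\ge 0$, profit $w_q\ge0$. Let $P_q$ be the simple path between $s_q$ and $t_q$, $R_e=\{q\in R:e\in P_q\}$, $k=|R|$, $m=|E|$. A set $X\subseteq R$ is feasible (routable) if $\sum_{q\in X\cap R_e}d_q\le u_e$ for all $e\in E$. Let $P=\{x\in[0,1]^R:\sum_{q\in R_e}d_qx_q\le u_e\ \forall e\in E\}$ and $P_I=\operatorname{conv}(P\cap\{0,1\}^R)$. For $S\subseteq E$ let $K(S)=\{x\in[0,1]^R:\sum_{q\in R_e}d_qx_q\le u_e\ \forall e\in S\}$, $K_I(S)=\operatorname{conv}(K(S)\cap\{0,1\}^R)$, and for $1\le t\le m$ let $P^t=\bigcap_{S\subseteq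 E,|S|=t}K_I(S)$. For $X\subseteq R$ let $\operatorname{rank}(X)=\max\{|Y|:Y\subseteq X,\ Y\text{ feasible}\}$; the rank constraint of $X$ is $\sum_{q\in X}x_q\le\operatorname{rank}(X)$. $P^t_{\operatorname{rank}}$ denotes the polytope of all $x\in P^t$ satisfying every rank constraint ($X\subseteq R$). $P^{k^c}$ means $P^t$ with $t=\lfloor k^c\rfloor$, and likewise for $P^{k^c}_{\operatorname{rank}}$. The integrality gap of a relaxation $Q\supseteq P_I$ is $\max\{w^Tx:x\in Q\}/\max\{w^Tx:x\in P_I\}$. Friggstad–Gao instance $T_{FG}^h$ ($h\ge2$): a rooted tree with root $r$ having a single child $v_1$; every vertex other than $r$ and the leaves has exactly $2^{h-1}$ children, and the leaves are at distance $h$ from $r$. Let $level_\ell$ be the set of vertices at distance $\ell$ from $r$, so $|level_\ell|=2^{(h-1)(\ell-1)}$ for $1\le\ell\le h$. An edge between $level_{\ell-1}$ and $level_\ell$ has capacity $2^{h(h-\ell+1)}$. For each $\ell\ge1$ and each $v\in level_\ell$ there is one request, with endpoints $v$ and $r$, demand $2^{h(h-\ell+1)}-2^{h(h-\ell)}$ and profit $2^{-(h-1)(\ell-1)}$. Thus $k=m=\sum_{i=0}^{h-1}2^{(h-1)i}$. *)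

(* Defs.v *)
From mathcomp Require Import all_boot all_order all_algebra.
From mathcomp Require Import boolp classical_sets reals.

Set Implicit Arguments.
Unset Strict Implicit.
Unset Printing Implicit Defensive.

Import Order.TTheory GRing.Theory Num.Theory.
Local Open Scope ring_scope.

Definition is_tree (V : finType) (adj : rel V) : Prop :=
  [/\ symmetric adj, irreflexive adj,
      (forall x y : V, connect adj x y)
    & (forall p : seq V, ucycle adj p -> (size p <= 2)%N)].

(* Edges are represented by their two-element sets of endpoints. *)
Definition edge_set (V : finType) (adj : rel V) : {set {set V}} :=
  [set [set z.1; z.2] | z : V * V & adj z.1 z.2].

Definition edges_of_path (V : finType) (x : V) (p : seq V) : seq {set V} :=
  pairmap (fun a b => [set a; b]) x p.

(* cap is total on vertex sets; its values outside the edges are never used. *)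
Record anf_tree (R : realType) := ANFTree {
  vertex : finType;
  adj : rel vertex;
  adj_tree : is_tree adj;
  cap : {set vertex} -> R;
  cap_gt0 : forall e, e \in edge_set adj -> 0 < cap e;
  request : finType;
  src : request -> vertex;
  dst : request -> vertex;
  src_neq_dst : forall q, src q != dst q;
  demand : request -> R;
  demand_ge0 : forall q, 0 <= demand q;
  profit : request -> R;
  profit_ge0 : forall q, 0 <= profit q
}.
Arguments adj {R} I : rename.
Arguments cap {R} I : rename.
Arguments src {R I} : rename.
Arguments dst {R I} : rename.
Arguments demand {R I} : rename.
Arguments profit {R I} : rename.

Section ANFTree.
Variables (R : realType) (I : anf_tree R).

Definition edges : {set {set vertex I}} := edge_set (adj I).

(* P_q; the simple path p is unique because the graph is a tree. *)
Definition req_path (q : request I) : {set {set vertex I}} :=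
  [set e | `[< exists p : seq (vertex I),
     [/\ path (adj I) (src q) p, last (src q) p = dst q,
         uniq (src q :: p) & e \in edges_of_path (src q) p] >]].

Definition req_on (e : {set vertex I}) : {set request I} :=
  [set q | e \in req_path q].

Definition feasible (X : {set request I}) : bool :=
  [forall e in edges, \sum_(q in X :&: req_on e) demand q <= cap I e].

Definition rank (X : {set request I}) : nat :=
  \max_(Y : {set request I} | (Y \subset X) && feasible Y) #|Y|.

Local Notation rvec := {ffun request I -> R}.

Definition zero_one : set rvec :=
  [set x : rvec | forall q, x q = 0 \/ x q = 1]%classic.

Definition conv_hull (A : set rvec) : set rvec :=
  [set x : rvec | exists (n : nat) (a : 'I_n -> R) (y : 'I_n -> rvec),
     [/\ forall i, 0 <= a i, \sum_i a i = 1, forall i, A (y i)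
       & forall q, x q = \sum_i a i * y i q]]%classic.

Definition relax (S : {set {set vertex I}}) : set rvec :=
  [set x : rvec | (forall q, 0 <= x q <= 1) /\
     (forall e, e \in S -> \sum_(q in req_on e) demand q * x q <= cap I e)]%classic.

Definition int_hull (S : {set {set vertex I}}) : set rvec :=
  conv_hull (relax S `&` zero_one)%classic.

Definition P_int : set rvec := int_hull edges.

Definition P_t (t : nat) : set rvec :=
  [set x : rvec | forall S : {set {set vertex I}},
     S \subset edges -> #|S| = t -> int_hull S x]%classic.

Definition P_t_rank (t : nat) : set rvec :=
  [set x : rvec | P_t t x /\
     (forall X : {set request I}, \sum_(q in X) x q <= (rank X)%:R)]%classic.

(* For a nonempty compact Q (such as the polytopes above, 1 <= t <= m), the
   supremum is the maximum of the profit over Q. *)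
Definition max_profit (Q : set rvec) : R :=
  sup [set \sum_q profit q * x q | x in Q]%classic.

Definition integrality_gap (Q : set rvec) : R :=
  max_profit Q / max_profit P_int.

End ANFTree.

(* A non-root vertex at distance l >= 1 from the root is a word of length l - 1
   over an alphabet of size 2^(h-1), its children being the one-letter
   extensions x :: b; None is the root r and Some [::] is v_1. Every word of
   length h - 1 is a leaf. *)
Section FriggstadGao.
Variable h : nat.

Local Notation fg_node := ((h.-1).-bseq 'I_(2 ^ h.-1)).

Definition fg_vertex : finType := option fg_node.

Definition fg_level (v : fg_vertex) : nat :=
  if v is Some b then (size b).+1 else 0%N.

Definition is_parent (u v : fg_vertex) : bool :=
  match u, v with
  | _, None => false
  | None, Some b => size b == 0%N
  | Some a, Some b => [exists x, (b : seq _) == x :: a]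
  end.

Definition fg_adj : rel fg_vertex := fun u v => is_parent u v || is_parent v u.

Lemma is_parent_level u v : is_parent u v -> fg_level v = (fg_level u).+1.
Proof.
case: u v => [a|] [b|] //=; first by case/existsP=> x /eqP ->.
by move/eqP=> ->.
Qed.

Lemma is_parent_inj u u' v : is_parent u v -> is_parent u' v -> u = u'.
Proof.
case: v => [b|]; last by case: u.
case: u u' => [a|] [a'|] //=.
- by case/existsP=> x /eqP -> /existsP[y /eqP[_ E]]; congr Some; apply/val_inj.
- by case/existsP=> x /eqP ->.
- by move=> /eqP E /existsP[x /eqP E']; rewrite E' in E.
Qed.

Lemma fg_adj_sym : symmetric fg_adj.
Proof. by move=> u v; rewrite /fg_adj orbC. Qed.

Lemma fg_adj_irr : irreflexive fg_adj.
Proof. by move=> u; apply/negP; case/orP => /is_parent_level /n_Sn. Qed.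

Lemma fg_connect_root v : connect fg_adj v None.
Proof.
move: {2}(fg_level v) (leqnn (fg_level v)) => n.
elim: n v => [|n IH] [b|] //= ltbn.
case: b ltbn => [[|x s] sz] /= ltbn.
  by apply: connect1; rewrite /fg_adj /=.
have sz' : (size s <= h.-1)%N by apply: ltnW.
apply: connect_trans (IH (Some (Bseq sz')) _) => //.
by apply: connect1; rewrite /fg_adj /= orbC; apply/orP; left; apply/existsP; exists x.
Qed.

Lemma fg_tree : is_tree fg_adj.
Proof.
split; [exact: fg_adj_sym | exact: fg_adj_irr | |].
  move=> x y; apply: connect_trans (fg_connect_root x) _.
  by rewrite (sym_connect_sym fg_adj_sym) fg_connect_root.
case=> [//|v0 p0]; set p := v0 :: p0 => /andP[cyc unq].
rewrite leqNgt; apply/negP => sz3.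
have v0p : v0 \in p by rewrite mem_head.
case: (@arg_maxnP _ v0 (mem p) fg_level v0p) => v vp vmax.
have [i q pE] := rot_to vp.
have vmax' w : w \in v :: q -> (fg_level w <= fg_level v)%N.
  by rewrite -pE mem_rot; apply: vmax.
have parE w : w \in v :: q -> fg_adj v w -> is_parent w v.
  move=> /vmax' lew /orP[/is_parent_level E|//].
  by rewrite E ltnn in lew.
have cq : cycle fg_adj (v :: q) by rewrite -pE rot_cycle.
have uq : uniq (v :: q) by rewrite -pE rot_uniq.
have sq : (2 < size (v :: q))%N by rewrite -pE size_rot.
case: q {pE vmax'} parE cq uq sq => [|a q] //= parE.
case/lastP: q parE => [|q b] //= parE.
rewrite !rcons_path !last_rcons => /andP[va /andP[_ bv]].
have pa : is_parent a v by apply: parE => //; rewrite !inE eqxx orbT.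
have pb : is_parent b v.
  by apply: parE; [rewrite !inE mem_rcons mem_head !orbT | rewrite fg_adj_sym].
by rewrite (is_parent_inj pa pb) mem_rcons mem_head /= andbF.
Qed.

Variable R : realType.

(* An edge between levels l - 1 and l is recognized by the larger level l. *)
Definition fg_cap (e : {set fg_vertex}) : R :=
  let l := (\max_(v in e) fg_level v)%N in 2 ^+ (h * (h - l + 1)).

Definition fg_src (q : fg_node) : fg_vertex := Some q.
Definition fg_dst (q : fg_node) : fg_vertex := None.

Definition fg_demand (q : fg_node) : R :=
  let l := fg_level (fg_src q) in 2 ^+ (h * (h - l + 1)) - 2 ^+ (h * (h - l)).

Definition fg_profit (q : fg_node) : R :=
  let l := fg_level (fg_src q) in 2 ^- (h.-1 * l.-1).

Lemma fg_cap_gt0 e : e \in edge_set fg_adj -> 0 < fg_cap e.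
Proof. by move=> _; rewrite exprn_gt0. Qed.

Lemma fg_src_neq_dst (q : fg_node) : fg_src q != fg_dst q.
Proof. by []. Qed.

Lemma fg_demand_ge0 q : 0 <= fg_demand q.
Proof.
rewrite subr_ge0 ler_weXn2l ?ler1n// leq_mul2l leq_addr orbT //.
Qed.

Lemma fg_profit_ge0 q : 0 <= fg_profit q.
Proof. by rewrite invr_ge0 exprn_ge0. Qed.

(* This is T_FG^h for h >= 2; smaller h give junk instances. *)
Definition fg_instance : anf_tree R :=
  ANFTree fg_tree fg_cap_gt0 fg_src_neq_dst fg_demand_ge0 fg_profit_ge0.

End FriggstadGao.

(* Main.v *)
(* Every request of depth i in the tree (v_1 has depth 0) fills the edge above
   it up to 2^-h of its capacity, and the requests strictly below it always fit
   in that edge when it is not chosen itself. So only the edges above chosen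
   requests matter, each asking the chosen requests strictly below to fit in a
   2^-h fraction of its capacity.

   The fractional point x has value 1/2 at the requests whose depth is a
   multiple of s >= 2 and 0 elsewhere; its profit is at least h/(2s). Requests
   of this support lying strictly below w are so small that 2^(h(s-1)) of them
   fit in the residual capacity at w. If S is a set of t <= 2^(h(s-1)) edges,
   then both the requests of the support whose upper edge is in S (at most t of
   them) and those whose upper edge is not in S respect S, and x is the average
   of their indicators. For the rank constraints, at most half of the requests
   of X in the support have more than 2^(h(s-1)) others of X below them, and the
   remaining ones are jointly feasible.

   A feasible set has profit at most 2: the chosen requests strictly below w
   have total profit at most that of w, because the ratio profit/demand is
   largest at the leaves, and the topmost chosen requests form an antichain, of
   profit at most 1. So both gaps are at least h/(4s): take s = 2 for fixed t,
   and s about ch for t = k^c, since k <= 2^(h(h-1)). *)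
Require Import Defs.
From mathcomp Require Import all_boot all_order all_algebra.
From mathcomp Require Import boolp classical_sets.
From mathcomp Require Import reals exp.
From mathcomp Require Import lra zify.

Set Implicit Arguments.
Unset Strict Implicit.
Unset Printing Implicit Defensive.

Import Order.TTheory GRing.Theory Num.Theory.
Local Open Scope ring_scope.

(** * Integer hulls and gap bounds on a general instance *)

Section Relaxations.
Variables (R : realType) (I : anf_tree R).
Implicit Types (S : {set {set vertex I}}) (X Y : {set request I}).
Local Notation rvec := {ffun request I -> R}.

Definition indicator X : rvec := [ffun q => (q \in X)%:R].

Definition fits S X : Prop :=
  forall e, e \in S -> \sum_(q in X :&: req_on e) demand q <= cap I e.

Lemma feasibleP X : reflect (fits (edges I) X) (feasible X).
Proof. exact: 'forall_implyP. Qed.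

Lemma sum_indicator X (P : pred (request I)) (F : request I -> R) :
  \sum_(q | P q) F q * indicator X q = \sum_(q in X | P q) F q.
Proof.
rewrite [RHS]big_mkcondl; apply: eq_bigr => q _.
by rewrite ffunE; case: (q \in X); rewrite ?mulr1 ?mulr0.
Qed.

Lemma indicator_relax S X : fits S X -> relax S (indicator X).
Proof.
move=> fX; split=> [q|e eS]; first by rewrite ffunE; case: (_ \in _); rewrite /= ?lexx ?ler01.
rewrite sum_indicator (eq_bigl (mem (X :&: req_on e))); first exact: fX.
by move=> q; rewrite /= finset.in_setI.
Qed.

Lemma indicator_zero_one X : zero_one (indicator X).
Proof. by move=> q; rewrite ffunE; case: (_ \in _); [right | left]. Qed.

Lemma relax_zero_oneP S (x : rvec) : relax S x -> zero_one x ->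
  exists2 X, fits S X & x = indicator X.
Proof.
move=> [_ xS] x01; exists [set q | x q == 1].
  move=> e /xS; apply: le_trans; rewrite [leRHS]big_mkcond [leLHS]big_mkcond /=.
  apply: ler_sum => q _; rewrite finset.in_setI inE.
  case: ifP => [/andP[/eqP -> ->]|_]; first by rewrite mulr1.
  case: ifP => // _; case: (x01 q) => ->; rewrite ?mulr0 ?mulr1//; exact: demand_ge0.
by apply/ffunP => q; rewrite ffunE inE; case: (x01 q) => ->; rewrite ?eqxx // eq_sym oner_eq0.
Qed.

Lemma half_indicators_int_hull S X Y (x : rvec) : fits S X -> fits S Y ->
  (forall q, x q = ((q \in X)%:R + (q \in Y)%:R) / 2) -> int_hull S x.
Proof.
move=> fX fY xE.
exists 2, (fun=> 1 / 2), (fun i => if i == 0 then indicator X else indicator Y).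
split=> [i||i|q]; rewrite ?big_ord_recl ?big_ord0 /=; try lra.
  by case: ifP => _; split; [exact: indicator_relax|exact: indicator_zero_one
    |exact: indicator_relax|exact: indicator_zero_one].
by rewrite !ffunE xE; lra.
Qed.

Lemma sum_profit_int_hull S (b : R) (x : rvec) :
  (forall X, fits S X -> \sum_(q in X) profit q <= b) -> int_hull S x ->
  \sum_q profit q * x q <= b.
Proof.
move=> Sb [n [a [y [a0 a1 Sy xE]]]].
under eq_bigr do rewrite xE mulr_sumr.
rewrite exchange_big /= -[leRHS]mul1r -a1 mulr_suml; apply: ler_sum => i _.
under eq_bigr do rewrite mulrCA; rewrite -mulr_sumr ler_wpM2l//.
have [yS y01] := Sy i; have [X fX ->] := relax_zero_oneP yS y01.
by rewrite sum_indicator; under eq_bigl do rewrite andbT; apply: Sb.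
Qed.

Lemma le_max_profit (Q : set rvec) (b : R) (x : rvec) :
  (forall y, Q y -> \sum_q profit q * y q <= b) -> Q x ->
  \sum_q profit q * x q <= max_profit Q.
Proof.
move=> Qb Qx; apply: ub_le_sup; last by exists x.
by exists b => _ [y Qy <-]; exact: Qb.
Qed.

(** [max_profit] is a [sup], meaningful only on bounded sets. With [t] at most the number of edges
    some [S] of size [t] exists, so [P_t t] lies in one hull; otherwise it would be the whole
    space. *)
Lemma sum_profit_P_t t (x : rvec) : (t <= #|edges I|)%N -> P_t t x ->
  \sum_q profit q * x q <= \sum_(q : request I) profit q.
Proof.
move=> tE Px.
have [S [SE St]] : exists S, S \subset edges I /\ #|S| = t.
  exists [set:: take t (enum (edges I))]; split.
    by apply/fintype.subsetP => e; rewrite inE => /mem_take; rewrite mem_enum.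
  rewrite cardsE (card_uniqP _) ?take_uniq ?enum_uniq//.
  by rewrite size_take_min -cardE; apply/minn_idPl.
apply: sum_profit_int_hull (Px S SE St) => X _.
rewrite big_mkcond; apply: ler_sum => q _; case: ifP => // _; exact: profit_ge0.
Qed.

(** [b] bounds the integral optimum from above; [X] makes it positive, so that dividing by it is
    sound. *)
Lemma le_integrality_gap t (b : R) (x : rvec) (X : {set request I}) :
  0 < b -> (t <= #|edges I|)%N ->
  (forall Y, feasible Y -> \sum_(q in Y) profit q <= b) ->
  feasible X -> 0 < \sum_(q in X) profit q ->
  (forall q, 0 <= x q) -> P_t_rank t x ->
  (\sum_q profit q * x q) / b <= integrality_gap (P_t (I := I) t) /\
  (\sum_q profit q * x q) / b <= integrality_gap (P_t_rank (I := I) t).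
Proof.
move=> b0 tE optb fX X0 x0 Px.
have Px_le (y : rvec) : P_int y -> \sum_q profit q * y q <= b.
  by apply: sum_profit_int_hull => Y /feasibleP; apply: optb.
have PX : P_int (indicator X).
  apply: half_indicators_int_hull (feasibleP X fX) (feasibleP X fX) _ => q.
  by rewrite ffunE; lra.
have optX : 0 < max_profit (P_int (I := I)).
  apply: lt_le_trans X0 _; apply: le_trans (le_max_profit Px_le PX).
  by rewrite sum_indicator; under [leRHS]eq_bigl do rewrite andbT.
have opt_le : max_profit (P_int (I := I)) <= b.
  apply: ge_sup; first by exists (\sum_q profit q * indicator X q), (indicator X).
  by move=> _ [y Py <-]; exact: Px_le.
have w0 : 0 <= \sum_q profit q * x q.
  by rewrite sumr_ge0// => q _; rewrite mulr_ge0 ?profit_ge0.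
have ratio (m : R) : \sum_q profit q * x q <= m ->
    (\sum_q profit q * x q) / b <= m / max_profit (P_int (I := I)).
  move=> xm; apply: le_trans (_ : _ <= m / b) _.
    by rewrite ler_pM2r ?invr_gt0.
  by rewrite ler_wpM2l ?lef_pV2 ?posrE// (le_trans w0).
split; apply: ratio; apply: (le_max_profit (b := \sum_(q : request I) profit q)) => //.
- by move=> y; apply: sum_profit_P_t.
- by case: Px.
- by move=> y [Py _]; apply: sum_profit_P_t Py.
Qed.

End Relaxations.

(** * Paths to the root and the requests using an edge *)

Section RootPaths.
Variable h : nat.
Local Notation node := ((h.-1).-bseq 'I_(2 ^ h.-1)).
Implicit Types (w q : node) (u v : fg_vertex h) (p : seq (fg_vertex h)).

(** Words grow at the front, so the parent is the tail and the ancestors of a vertex are its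
    suffixes. *)
Definition fg_parent w : fg_vertex h :=
  if w is Bseq (_ :: s) sz then Some (Bseq (ltnW sz)) else None.

(** Edges are named by their lower endpoint, which puts them in bijection with the requests. *)
Definition fg_edge w : {set fg_vertex h} := [set Some w; fg_parent w].

Lemma is_parentE u w : is_parent u (Some w) = (u == fg_parent w).
Proof.
case: w => [[|x s] sz]; case: u => [a|] //.
  by apply/existsP => -[].
apply/existsP/eqP => [[y /eqP[_ sa]]|[->]]; last by exists x.
by congr Some; apply/val_inj; rewrite /= sa.
Qed.

Lemma level_fg_parent w : fg_level (fg_parent w) = size w.
Proof. by case: w => [[|x s] sz]. Qed.

Lemma suffix_fg_parent w q a : fg_parent q = Some a ->
  suffix w q = (w == q) || suffix w a.
Proof.
case: q => [[|x s] sz] //= [<-] /=; rewrite -val_eqE /=.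
apply/idP/orP => [/suffixP[[|y z] /= E]|[/eqP ->|/suffix_trans->//]].
- by left; rewrite E.
- by right; case: E => _ ->; exact: suffix_suffix.
- exact: suffix_refl.
- exact: suffix_cons.
Qed.

Lemma suffix_fg_root w q : fg_parent q = None -> suffix w q = (w == q).
Proof. by case: q => [[|x s] sz] // _; rewrite -val_eqE /= suffixs0. Qed.

(* The edge above w is the only way out of the subtree of w. *)
Lemma root_path_meets_parent w q : suffix w q -> forall p,
  path (@fg_adj h) (Some q) p -> last (Some q) p = None -> fg_parent w \in p.
Proof.
move=> wq p; elim: p q wq => [//|v p IH] q wq /= /andP[qv pp] lp.
rewrite inE; case: (v =P fg_parent w) => [->|vw]; first by rewrite eqxx.
have/negPf-> : fg_parent w != v by apply/eqP => E; apply: vw.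
move: qv; rewrite /fg_adj orbC is_parentE => /orP[/eqP vq|].
  move: wq vw; case: v vq pp lp => [a|] /esym vq pp lp.
    rewrite (suffix_fg_parent _ vq) => /predU1P[->|wa _]; first by rewrite vq.
    exact: IH wa pp lp.
  by rewrite (suffix_fg_root _ vq) => /eqP ->; rewrite vq.
case: v vw pp lp => [a|] // vw pp lp; rewrite is_parentE => /eqP/esym qa.
by apply: IH pp lp; rewrite (suffix_fg_parent _ qa) wq orbT.
Qed.

(** A simple path to the root never descends: after a step from [q] down to a child,
    [root_path_meets_parent] forces a return to [q]. *)
Lemma edges_root_path p q e : path (@fg_adj h) (Some q) p ->
  last (Some q) p = None -> uniq (Some q :: p) ->
  e \in edges_of_path (Some q) p -> exists2 w : node, suffix w q & e = fg_edge w.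
Proof.
elim: p q => [//|v p IH] q /= /andP[qv pp] lp /and3P[qp vp up].
rewrite inE => /predU1P[->|ep].
  exists q; first exact: suffix_refl.
  congr [set _; _]; move: qv; rewrite /fg_adj orbC is_parentE => /orP[/eqP //|].
  case: v pp lp vp qp => [a|] // pp lp _ qp; rewrite is_parentE => /eqP qa.
  by have := root_path_meets_parent (suffix_refl a) pp lp; rewrite -qa => qp'; rewrite inE qp' orbT in qp.
move: qv; rewrite /fg_adj orbC is_parentE => /orP[/eqP vq|].
  case: v vq pp lp vp {qp} ep => [a|] /esym vq pp lp vp ep; last first.
    by case: p pp lp vp ep {IH up} => [//|u p] _ /= <-; rewrite mem_last.
  have [] := IH a pp lp _ ep; first by rewrite /= vp.
  by move=> w wa ->; exists w; rewrite ?(suffix_fg_parent _ vq) ?wa ?orbT.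
case: v pp lp vp qp ep => [a|] // pp lp _ qp _; rewrite is_parentE => /eqP qa.
by have := root_path_meets_parent (suffix_refl a) pp lp; rewrite -qa => qp'; rewrite inE qp' orbT in qp.
Qed.

(** The level bound serves the induction: it keeps [q] off the path that starts at its parent. *)
Lemma root_path q : exists p,
  [/\ path (@fg_adj h) (Some q) p, last (Some q) p = None, uniq (Some q :: p),
      forall v, v \in p -> (fg_level v <= size q)%N
    & forall w : node, suffix w q -> fg_edge w \in edges_of_path (Some q) p].
Proof.
have [n] := ubnP (size q); elim: n q => [//|n IH] q; rewrite ltnS => qn.
have adjq : fg_adj (Some q) (fg_parent q).
  by rewrite fg_adj_sym /fg_adj is_parentE eqxx.
case E: (fg_parent q) (level_fg_parent q) adjq => [a|] /= lq adjq.
  have [|p [pp lp up vp ep]] := IH a; first by rewrite lq.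
  exists (Some a :: p); split=> [|//|||w] /=; first by rewrite adjq.
  - rewrite -/(uniq (Some a :: p)) up andbT inE negb_or; apply/andP; split.
      by apply/eqP => -[qa]; move: lq; rewrite qa => /esym/n_Sn.
    by apply/negP => /vp /=; rewrite -lq; lia.
  - by move=> v; rewrite inE => /predU1P[->|/vp]; rewrite /= -lq //; lia.
  rewrite (suffix_fg_parent _ E) inE => /predU1P[->|wa].
    by rewrite /fg_edge E eqxx.
  by rewrite ep ?orbT.
exists [:: None]; split=> [||||w] /=; rewrite ?adjq //.
  by move=> v; rewrite inE => /eqP->.
by rewrite (suffix_fg_root _ E) inE => /eqP->; rewrite /fg_edge E.
Qed.

Lemma fg_edge_inj : injective fg_edge.
Proof.
move=> w w' E; have : Some w \in fg_edge w' by rewrite -E !inE eqxx.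
have : Some w' \in fg_edge w by rewrite E !inE eqxx.
rewrite !inE => /orP[/eqP[->]//|/eqP w'w] /orP[/eqP[->]//|/eqP ww'].
by have := level_fg_parent w; have := level_fg_parent w'; rewrite -w'w -ww' /=; lia.
Qed.

Lemma fg_edges : edge_set (@fg_adj h) = [set fg_edge w | w : node].
Proof.
apply/setP => e; apply/imsetP/imsetP => [[[u v] /=]|[w _ ->]].
  rewrite inE /= => /orP[uv ->|uv ->].
    case: v uv => [w|]; last by case: u.
    by rewrite is_parentE => /eqP->; exists w => //; rewrite finset.setUC.
  case: u uv => [w|]; last by case: v.
  by rewrite is_parentE => /eqP->; exists w.
by exists (Some w, fg_parent w); rewrite // inE /= /fg_adj is_parentE eqxx orbT.
Qed.

Variable R : realType.

Lemma fg_capE w : (0 < h)%N -> fg_cap R (fg_edge w) = 2 ^+ (h * (h - size w)).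
Proof.
move=> h0; rewrite /fg_cap /fg_edge; congr (_ ^+ (h * _)).
have -> : (\max_(v in [set Some w; fg_parent w]) fg_level v = (size w).+1)%N.
  apply/eqP; rewrite eqn_leq; apply/andP; split.
    apply/bigmax_leqP => v; rewrite !inE => /orP[] /eqP-> //=.
    by rewrite level_fg_parent.
  by apply: (@leq_bigmax_cond _ _ (@fg_level h) (Some w)); rewrite !inE eqxx.
by have := size_bseq w; lia.
Qed.

Lemma req_on_fg_edge w :
  req_on (I := fg_instance h R) (fg_edge w) = [set q : node | suffix w q].
Proof.
apply/setP => q; rewrite !inE; apply/asboolP/idP => [[p [pp lp up ep]]|wq].
  by have [w' w'q /fg_edge_inj->] := edges_root_path pp lp up ep.
by have [p [pp lp up _ ep]] := root_path q; exists p; split=> //; exact: ep.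
Qed.

End RootPaths.

(** * Loads of subtrees, level by level *)

Lemma level_exponent (h i j : nat) : (i <= j)%N -> (j < h)%N ->
  (h * (h - j) + h.-1 * (j - i) + (j - i) = h * (h - i))%N.
Proof.
move=> ij jh; rewrite -addnA addnC -mulSnr prednK; last by lia.
by rewrite -mulnDr; congr (h * _)%N; lia.
Qed.

Lemma geometric_sum_le1 (R : realType) (i m : nat) :
  \sum_(0 <= j < m | (i < j)%N) 2 ^- (j - i) <= 1 :> R.
Proof.
(* The induction on [m] needs the remainder of the series; for [m <= i + 1] truncated subtraction
   makes this bound 0. *)
suff: \sum_(0 <= j < m | (i < j)%N) 2 ^- (j - i) <= 1 - 2 ^- (m.-1 - i) :> R.
  by move=> /le_trans; apply; rewrite gerBl invr_ge0 exprn_ge0.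
rewrite big_mkcond; elim: m => [|m IH]; first by rewrite big_geq// expr0 invr1 subrr.
rewrite big_nat_recr//=; have [im|mi] := ltnP i m.
  apply: le_trans (lerD IH (lexx _)) _.
  have -> : (m - i = (m.-1 - i).+1)%N by lia.
  by rewrite exprS invfM; lra.
rewrite addr0; apply: le_trans IH _.
by have -> : (m.-1 - i = m - i)%N by lia.
Qed.

Section Loads.
Variables (R : realType) (h : nat).
Hypothesis h_gt0 : (0 < h)%N.
Local Notation node := ((h.-1).-bseq 'I_(2 ^ h.-1)).
Local Notation I := (fg_instance h R).
Implicit Types (w q : node) (X Y : {set node}).

Definition below w q : bool := suffix w q && (w != q).

Lemma below_size w q : below w q -> (size w < size q)%N.
Proof.
move=> /andP[/suffixP[[|x s] E] wq]; last by rewrite E size_cat ltnS leq_addl.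
by case/eqP: wq; apply/val_inj.
Qed.

Lemma suffix_below w q : suffix w q = (w == q) || below w q.
Proof. by rewrite /below; case: eqP => [->|_]; rewrite ?suffix_refl ?andbT. Qed.

Lemma suffixes_comparable w w' q : suffix w q -> suffix w' q ->
  (size w <= size w')%N -> suffix w w'.
Proof.
rewrite -!prefix_rev !prefixE !size_rev => /eqP <- /eqP <- ww'.
by rewrite take_takel.
Qed.

Lemma suffix_size_inj w w' q : suffix w q -> suffix w' q ->
  size w = size w' -> w = w'.
Proof.
by rewrite !suffixE => /eqP wq /eqP w'q E; apply/val_inj; rewrite /= -wq E w'q.
Qed.

Lemma card_suffix_level w (j : nat) : (size w <= j)%N -> (j < h)%N ->
  #|[pred q : node | suffix w q & size q == j]| = (2 ^ (h.-1 * (j - size w)))%N.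
Proof.
move=> wj jh.
transitivity #|{: (j - size w).-tuple 'I_(2 ^ h.-1)}|; last first.
  by rewrite card_tuple card_ord -expnM.
have catP (t : (j - size w).-tuple 'I_(2 ^ h.-1)) : (size (t ++ w) <= h.-1)%N.
  by rewrite size_cat size_tuple; lia.
pose f t : node := Bseq (catP t).
have f_inj : injective f.
  move=> t t' /(congr1 val) /= /eqP; rewrite eqseq_cat ?size_tuple// => /andP[/eqP tt' _].
  exact/val_inj.
rewrite -(card_codom f_inj); apply: eq_card => q; rewrite !inE.
apply/andP/codomP => [[/suffixP[s E] /eqP qj]|[t ->]].
  have sz : size s == (j - size w)%N by rewrite -qj E size_cat addnK.
  by exists (Tuple sz); apply/val_inj.
by rewrite suffix_suffix /= size_cat size_tuple subnK.
Qed.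

Lemma fg_demandE q :
  fg_demand R q = 2 ^+ (h * (h - size q)) - 2 ^+ (h * (h.-1 - size q)).
Proof.
rewrite /fg_demand /=; have := size_bseq q => qh.
by congr (_ ^+ (h * _) - _ ^+ (h * _)); lia.
Qed.

Lemma fg_demand_le q : fg_demand R q <= 2 ^+ (h * (h - size q)).
Proof. by rewrite fg_demandE gerBl exprn_ge0. Qed.

Lemma sum_by_level (P : pred node) (F : node -> R) :
  \sum_(q | P q) F q = \sum_(0 <= j < h) \sum_(q | P q && (size q == j)) F q.
Proof.
have qh q : (size q < h)%N by have := size_bseq q; lia.
rewrite big_mkord (partition_big (fun q => Ordinal (qh q)) predT) //=.
Qed.

(** There are [2^((h-1)(j-i))] vertices of depth [j] below a [w] of depth [i], each of demand at
    most [2^(h(h-j))]. By [level_exponent] they take at most a share [2^-(j-i)] of the capacity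
    above [w], and these shares sum to at most 1. *)
Lemma sum_demand_below w :
  \sum_(q | below w q) fg_demand R q <= 2 ^+ (h * (h - size w)).
Proof.
rewrite sum_by_level.
apply: le_trans (_ : \sum_(0 <= j < h | (size w < j)%N)
    2 ^+ (h * (h - size w)) * 2 ^- (j - size w) <= _); last first.
  rewrite -mulr_sumr ler_piMr ?exprn_ge0//; exact: geometric_sum_le1.
rewrite [leRHS]big_mkcond; apply: ler_sum_nat => j /andP[_ jh]; case: ifP => [wj|/negbT wj].
  have -> : 2 ^+ (h * (h - size w)) / 2 ^+ (j - size w) =
      2 ^+ (h * (h - j)) *+ (2 ^ (h.-1 * (j - size w))) :> R.
    apply/eqP; rewrite eq_sym -mulr_natr natrX -exprD eq_sym.
    rewrite -(inj_eq (mulIf (_ : 2 ^+ (j - size w) != 0))) ?expf_neq0 ?pnatr_eq0//.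
    rewrite divfK ?expf_neq0 ?pnatr_eq0// -exprD.
    by rewrite level_exponent // ltnW.
  rewrite -(card_suffix_level (ltnW wj) jh) -sumr_const.
  rewrite [leLHS]big_mkcond [leRHS]big_mkcond /=; apply: ler_sum => q _.
  rewrite !inE /below; case: (size q =P j) => [<-|_]; rewrite ?andbF//.
  case: suffix => //=; case: ifP => _; rewrite ?exprn_ge0//; exact: fg_demand_le.
rewrite big1// => q /andP[/below_size wq /eqP qj]; by rewrite -qj wq in wj.
Qed.

Lemma sum_profit_level (j : nat) : (j < h)%N ->
  \sum_(q : node | size q == j) fg_profit R q = 1.
Proof.
move=> jh; transitivity (\sum_(q : node | suffix [::] q && (size q == j)) 2 ^- (h.-1 * j) : R).
  by apply: eq_big => [q|q /eqP qj]; rewrite ?suffix0s// /fg_profit /= qj.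
have := card_suffix_level (w := nil_bseq _ _) (leq0n j) jh; rewrite /= subn0 => E.
by rewrite sumr_const -(eq_card (A := [pred q : node | suffix [::] q & size q == j])) // E
  -(mulr_natr _ (2 ^ _)%N) natrX mulVf // expf_neq0 // pnatr_eq0.
Qed.

(** The demand of a chosen [w] leaves exactly [2^(h(h-1-size w))] of the capacity of its edge; edges
    above unchosen requests are covered by [sum_demand_below]. *)
Lemma fitsP (S : {set {set vertex I}}) Y : S \subset edges I ->
  (forall w, w \in Y -> fg_edge w \in S ->
    \sum_(q in Y | below w q) fg_demand R q <= 2 ^+ (h * (h.-1 - size w))) ->
  fits S (Y : {set request I}).
Proof.
move=> SE YS e eS; have := fintype.subsetP SE e eS.
have -> : edges I = [set fg_edge w | w : node] by exact: fg_edges.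
move=> /imsetP[w _ ew]; subst e.
rewrite [cap _ _]fg_capE// req_on_fg_edge.
have -> : \sum_(q in (Y : {set request I}) :&: [set q : node | suffix w q]) demand q =
    \sum_(q in Y | (w == q) || below w q) fg_demand R q.
  by apply: eq_bigl => q; rewrite !inE suffix_below.
have [wY|wY] := boolP (w \in Y).
  rewrite (bigD1 w) /=; last by rewrite wY eqxx.
  rewrite (eq_bigl (fun q => (q \in Y) && below w q)) => [|q]; last first.
    by rewrite /below eq_sym; case: eqP => _; rewrite ?andbT ?andbF.
  apply: le_trans (lerD (lexx _) (YS w wY eS)) _.
  by rewrite fg_demandE subrK.
apply: le_trans (sum_demand_below w).
rewrite [leLHS]big_mkcond [leRHS]big_mkcond; apply: ler_sum => q _.
case: (w =P q) => [<-|_]; first by rewrite (negPf wY); case: ifP => _; rewrite ?fg_demand_ge0.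
by case: (below w q); rewrite ?andbF //; case: (q \in Y); rewrite ?fg_demand_ge0.
Qed.

End Loads.

(** * The half-integral point satisfies the hull and rank constraints *)

Section FractionalSolution.
Variables (R : realType) (h : nat).
Hypothesis h_gt1 : (1 < h)%N.
Local Notation node := ((h.-1).-bseq 'I_(2 ^ h.-1)).
Local Notation I := (fg_instance h R).
Implicit Types (w q : node) (X Y : {set node}) (s t : nat).

Let h_gt0 : (0 < h)%N. Proof. exact: ltnW. Qed.

Lemma card_fg_edges : #|edges I| = #|{: node}|.
Proof. by rewrite -(card_imset _ (@fg_edge_inj h)) -fg_edges. Qed.

Lemma sparse_fits (S : {set {set vertex I}}) Y s : (0 < s)%N ->
  S \subset edges I -> (forall q, q \in Y -> (s %| size q)%N) ->
  (forall w, w \in Y -> fg_edge w \in S ->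
    (#|[set q in Y | below w q]| <= 2 ^ (h * s.-1))%N) ->
  fits S (Y : {set request I}).
Proof.
move=> s0 SE Ys YS; apply: fitsP => // w wY wS.
(* [D] is the room left at [w] split into [2^(h(s-1))] equal shares. Depths are multiples of [s], so
   a request below [w] is at least [s] deeper and its demand is at most [D]. *)
pose D : R := 2 ^+ (h * (h.-1 - size w)) / 2 ^+ (h * s.-1).
apply: le_trans (_ : \sum_(q in Y | below w q) D <= _).
  apply: ler_sum => q /andP[qY wq]; apply: le_trans (fg_demand_le R h_gt0 q) _.
  rewrite ler_pdivlMr ?exprn_gt0// -exprD ler_weXn2l ?ler1n// -mulnDr leq_mul2l.
  apply/orP; right; have /dvdnP[a wa] := Ys w wY; have /dvdnP[b qb] := Ys q qY.
  have := below_size wq; have := size_bseq q; rewrite wa qb ltn_mul2r => bh /andP[_ ab].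
  have : (a.+1 * s <= b * s)%N by rewrite leq_mul2r ab orbT.
  by rewrite mulSn; lia.
rewrite sumr_const -(eq_card (A := [set q in Y | below w q])); last by move=> q; rewrite !inE.
rewrite -(mulr_natr _ #|_|) /D -mulrA ler_piMr ?exprn_ge0//.
by rewrite mulrC ler_pdivrMr ?exprn_gt0// mul1r -natrX ler_nat; exact: YS.
Qed.

Definition half_on_multiples s : {ffun request I -> R} :=
  [ffun q : node => if (s %| size q)%N then 1 / 2 else 0].

Lemma half_on_multiples_P_t s t : (0 < s)%N -> (t <= 2 ^ (h * s.-1))%N ->
  P_t t (half_on_multiples s).
Proof.
move=> s0 ts S SE St.
pose L := [set q : node | (s %| size q)%N]; pose E := [set q : node | fg_edge q \in S].
have E_le : (#|E| <= t)%N.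
  rewrite -St -(card_imset (mem E) (@fg_edge_inj h)); apply/subset_leq_card.
  by apply/fintype.subsetP => e /imsetP[q + ->]; rewrite inE.
have fLE : fits S (L :&: E : {set request I}).
  apply: sparse_fits s0 SE _ _ => [q|w _ _]; first by rewrite !inE => /andP[].
  apply: leq_trans (leq_trans E_le ts); apply/subset_leq_card/fintype.subsetP => q.
  by rewrite !inE => /andP[/andP[]].
(* No request kept here has its upper edge in [S], so the counting hypothesis of [sparse_fits] is
   vacuous. *)
have fLD : fits S (L :\: E : {set request I}).
  apply: sparse_fits s0 SE _ _ => [q|w]; first by rewrite !inE => /andP[].
  by rewrite !inE => /andP[/negPf->].
apply: half_indicators_int_hull fLE fLD _ => q; rewrite ffunE !inE.
by case: (_ %| _)%N; case: (_ \in S) => /=; lra.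
Qed.

Lemma card_below q : (#|[set w | below w q]| <= h.-1)%N.
Proof.
rewrite cardE -(size_map (fun w : node => size w)) -[X in (_ <= X)%N](size_iota 0 h.-1).
apply: uniq_leq_size => [|_ /mapP[w + ->]].
  rewrite map_inj_in_uniq ?enum_uniq// => w w'; rewrite !mem_enum !inE.
  move=> /andP[wq _] /andP[w'q _]; exact: suffix_size_inj wq w'q.
by rewrite mem_enum inE mem_iota => /below_size wq; have := size_bseq q; lia.
Qed.

(* Markov: a request lies below at most h - 1 others, and 2(h - 1) <= 2^h. *)
Lemma card_heavy X s : (1 < s)%N ->
  (2 * #|[set w in X | 2 ^ (h * s.-1) < #|[set q in X | below w q]|]| <= #|X|)%N.
Proof.
move=> s1; set H := [set w in X | _]; set K := (2 ^ (h * s.-1))%N.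
(* Pairs of a heavy [w] and a request of [X] below it are counted in both orders. *)
have HK : (#|H| * K <= #|X| * h.-1)%N.
  rewrite -!sum_nat_const; apply: leq_trans (_ : \sum_(w in H) \sum_(q in X) below w q <= _)%N.
    apply: leq_sum => w; rewrite inE => /andP[_ /ltnW/leq_trans]; apply.
    rewrite -sum1_card [leqRHS]big_mkcond [leqLHS]big_mkcond; apply: leq_sum => q _.
    by rewrite inE; case: (q \in X); case: (below w q).
  rewrite exchange_big; apply: leq_sum => q _; apply: leq_trans (card_below q).
  rewrite -sum1_card [leqRHS]big_mkcond [leqLHS]big_mkcond; apply: leq_sum => w _.
  by rewrite inE; case: (w \in H); case: (below w q).
have hK : (2 * h.-1 <= K)%N.
  apply: (@leq_trans (2 ^ h)); last by rewrite leq_exp2l// leq_pmulr//; lia.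
  by rewrite -{2}(prednK h_gt0) expnS leq_mul2l /= ltnW// ltn_expl.
have := leq_trans (leq_mul (leqnn #|H|) hK) HK.
by rewrite mulnA leq_mul2r mulnC; case: (h.-1 =P 0)%N => [|_ //]; lia.
Qed.

Lemma half_on_multiples_rank s (X : {set request I}) : (1 < s)%N ->
  \sum_(q in X) half_on_multiples s q <= (rank X)%:R.
Proof.
move=> s1; pose X' : {set node} := [set q : node in X | (s %| size q)%N].
have X'L q : q \in X' -> (s %| size q)%N by rewrite inE => /andP[].
set H := [set w in X' | (2 ^ (h * s.-1) < #|[set q in X' | below w q]|)%N].
have HX' : H \subset X' by apply/fintype.subsetP => q; rewrite inE => /andP[].
have -> : \sum_(q in X) half_on_multiples s q = #|X'|%:R / 2.
  rewrite -sumr_const mulr_suml [LHS]big_mkcond [RHS]big_mkcond; apply: eq_bigr => q _.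
  by rewrite inE ffunE; case: (q \in X); case: (_ %| _)%N.
have rk : (#|X' :\: H| <= rank X)%N.
  apply: (@leq_bigmax_cond _ _ (fun Y : {set request I} => #|Y|) (X' :\: H)).
  apply/andP; split.
    by apply/fintype.subsetP => q; rewrite !inE => /andP[_ /andP[]].
  apply/feasibleP; apply: (sparse_fits (s := s)) => [|//|q|w]; first exact: ltnW.
    by rewrite inE => /andP[_ /X'L].
  rewrite inE => /andP[wH wX'] _; rewrite inE wX' /= -leqNgt in wH.
  apply: leq_trans wH; apply/subset_leq_card/fintype.subsetP => q.
  by rewrite !inE => /andP[/andP[_ ->] ->].
rewrite ler_pdivrMr ?ltr0n// -natrM ler_nat mulnC.
apply: leq_trans (_ : 2 * #|X' :\: H| <= _)%N; last by rewrite leq_mul2l rk.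
have := card_heavy X' s1; rewrite -/H cardsD (finset.setIidPr HX').
by have := subset_leq_card HX'; lia.
Qed.

Lemma profit_half_on_multiples s : (0 < s)%N ->
  h%:R / (2 * s)%:R <= \sum_(q : request I) profit q * half_on_multiples s q.
Proof.
move=> s0.
have -> : \sum_(q : request I) profit q * half_on_multiples s q =
    (\sum_(q : node | (s %| size q)%N) fg_profit R q) / 2.
  rewrite mulr_suml [RHS]big_mkcond; apply: eq_bigr => q _.
  by rewrite ffunE; case: ifP => _; rewrite ?mulr0// mul1r.
rewrite sum_by_level// (eq_big_nat _ _ (F2 := fun j => (s %| j)%N%:R)) => [|j /andP[_ jh]].
  (* There are [1 + (h-1) %/ s] multiples of [s] below [h], the 1 being depth 0; times [s] this is
     at least [h]. *)
  rewrite -natr_sum ler_pdivrMr ?ltr0n ?muln_gt0// natrM mulrA divfK ?pnatr_eq0//.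
  rewrite -natrM ler_nat big_ltn// dvdn0 -[X in index_iota _ X](prednK h_gt0).
  rewrite -divn_count_dvd mulnDl mul1n.
  by have := divn_eq h.-1 s; have := ltn_pmod h.-1 s0; lia.
case: (boolP (s %| j)%N) => sj; last first.
  by rewrite big1// => q /andP[+ /eqP qj]; rewrite qj (negPf sj).
rewrite -(sum_profit_level R h_gt0 jh); apply: eq_bigl => q.
by case: eqP => [->|]; rewrite ?sj ?andbF.
Qed.

(** * Feasible sets have profit at most 2 *)

Lemma sum_suffixes (P : pred node) (F : node -> R) Y :
  \sum_(w in Y) \sum_(q | P q && suffix w q) F q =
  \sum_(q | P q) F q *+ #|[set w in Y | suffix w q]|.
Proof.
under eq_bigr do rewrite big_mkcondr.
rewrite exchange_big; apply: eq_bigr => q _ /=.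
rewrite -sumr_const [LHS]big_mkcond [RHS]big_mkcond; apply: eq_bigr => w _.
by rewrite inE; case: (w \in Y).
Qed.

Definition top Y := [set w in Y | ~~ [exists v in Y, below v w]].

(** Ancestors of [q] form a chain, so of two distinct ones in [Y] the deeper lies below the other
    and is not in [top Y]. *)
Lemma top_suffix_inj Y w w' q : w \in top Y -> w' \in top Y ->
  suffix w q -> suffix w' q -> w = w'.
Proof.
wlog ww' : w w' / (size w <= size w')%N.
  by move=> W wT w'T wq w'q; case/orP: (leq_total (size w) (size w')) => /W E;
    [|symmetry]; apply: E.
move=> wT; rewrite inE => /andP[_ /existsPn/(_ w)] + wq w'q.
move: wT; rewrite inE => /andP[-> _] /=; apply: contraNeq => ne.
by rewrite /below ne (suffixes_comparable wq w'q ww').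
Qed.

Lemma top_exists Y q : q \in Y -> exists2 w, w \in top Y & suffix w q.
Proof.
move=> qY; pose P w := (w \in Y) && suffix w q.
have Pq : P q by rewrite /P qY suffix_refl.
case: (arg_minnP (fun w : node => size w) Pq) => w /andP[wY wq] wmin.
exists w; rewrite // inE wY; apply/existsPn => v; apply/negP => /andP[vY vw].
have := wmin v; rewrite /P vY (suffix_trans (andP vw).1 wq) => /(_ isT).
by have := below_size vw; lia.
Qed.

(** The profit [2^-((h-1) size w)] is the fraction of all leaves that lie in the subtree of [w], and
    leaf profits are uniform with total 1. *)
Lemma profit_leaves w :
  fg_profit R w = \sum_(q : node | (size q == h.-1) && suffix w q) fg_profit R q.
Proof.
rewrite (eq_bigl [pred q : node | suffix w q & size q == h.-1]) => [|q]; last by rewrite inE andbC.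
rewrite (eq_bigr (fun=> 2 ^- (h.-1 * h.-1))) => [|q /andP[_ /eqP qh]]; last by rewrite /fg_profit /= qh.
have wh := size_bseq w.
rewrite sumr_const card_suffix_level ?prednK// -(mulr_natr _ (2 ^ _)%N) natrX /fg_profit /=.
have -> : (h.-1 * h.-1 = h.-1 * (h.-1 - size w) + h.-1 * size w)%N.
  by rewrite -mulnDr subnK.
by rewrite exprD invfM mulrAC mulVf ?mul1r// expf_neq0// pnatr_eq0.
Qed.

(** Kraft's inequality for suffix-free codes: each leaf lies in the subtree of at most one member of
    [top Y]. *)
Lemma kraft Y : \sum_(w in top Y) fg_profit R w <= 1.
Proof.
under eq_bigr do rewrite profit_leaves.
have hh : (h.-1 < h)%N by rewrite ltn_predL.
rewrite sum_suffixes -(sum_profit_level R h_gt0 hh).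
apply: ler_sum => q _; rewrite -[leRHS]mulr1n ler_wpMn2l ?fg_profit_ge0//.
apply/card_le1_eqP => w w'; rewrite inE => /andP[wT wq]; rewrite inE => /andP[w'T w'q].
exact: top_suffix_inj w'T wT w'q wq.
Qed.

(** Multiplied by [2^(h(h-1))], the claim at depth [i] reads [2^i E <= (2^h - 1) E] with
    [E = 2^(h(h-1-i))], and [i <= h-1]. *)
Lemma profit_le_demand q : fg_profit R q <= fg_demand R q / 2 ^+ (h * h.-1).
Proof.
rewrite ler_pdivlMr ?exprn_gt0// fg_demandE// /fg_profit /=.
have qh := size_bseq q.
set i := size q in qh *; set E := 2 ^+ (h * (h.-1 - i)) : R.
have -> : 2 ^+ (h * (h - i)) = 2 * 2 ^+ h.-1 * E.
  rewrite -exprS prednK// -exprD -[X in (X + _)%N]muln1 -mulnDr.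
  by congr (_ ^+ (_ * _)); lia.
have -> : 2 ^+ (h * h.-1) = 2 ^+ (h.-1 * i) * 2 ^+ i * E.
  rewrite -!exprD; congr (_ ^+ _).
  by rewrite -{1}(subnK qh) mulnDr addnC [(_ * i + i)%N]addnC -mulSn prednK.
rewrite !mulrA mulVf ?expf_neq0 ?pnatr_eq0// mul1r -[X in _ - X]mul1r -mulrBl ler_wpM2r ?exprn_ge0//.
have : 2 ^+ i <= 2 ^+ h.-1 :> R by rewrite ler_weXn2l ?ler1n.
have : 1 <= 2 ^+ h.-1 :> R by rewrite exprn_ege1 ?ler1n.
lra.
Qed.

Lemma feasible_below (Y : {set request I}) w : feasible Y -> w \in Y ->
  \sum_(q in Y | below w q) fg_demand R q <= 2 ^+ (h * (h.-1 - size w)).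
Proof.
move=> /feasibleP/(_ (fg_edge w)) fY wY.
have /fY : fg_edge w \in edges I by rewrite /edges [edge_set _]fg_edges imset_f.
rewrite [cap _ _]fg_capE// req_on_fg_edge.
rewrite (bigD1 w) /=; last by rewrite !inE wY suffix_refl.
rewrite fg_demandE//.
rewrite (eq_bigl (fun q => (q \in Y) && below w q)) => [|q]; last first.
  by rewrite !inE /below eq_sym andbA.
rewrite /=; lra.
Qed.

Lemma fg_opt_le2 (Y : {set request I}) : feasible Y -> \sum_(q in Y) profit q <= 2.
Proof.
move=> fY; apply: le_trans (_ : \sum_(w in top Y) 2 * fg_profit R w <= _); last first.
  by rewrite -mulr_sumr; have := kraft Y; lra.
(* Every chosen request lies under a topmost one, so regrouping by [top Y] loses nothing. *)
apply: le_trans (_ : \sum_(w in top Y) \sum_(q in Y | suffix w q) fg_profit R q <= _).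
  rewrite sum_suffixes; apply: ler_sum => q qY.
  rewrite -[leLHS]mulr1n ler_wpMn2l ?fg_profit_ge0// card_gt0.
  by have [w wT wq] := top_exists qY; apply/set0Pn; exists w; rewrite inE wT.
apply: ler_sum => w; rewrite inE => /andP[wY _].
rewrite (bigD1 w) /=; last by rewrite wY suffix_refl.
rewrite mulr_natl mulr2n lerD2l.
rewrite (eq_bigl (fun q => (q \in Y) && below w q)) => [|q]; last first.
  by rewrite /below eq_sym andbA.
(* With [i] the depth of [w], the demand below is at most [2^(h(h-1-i))], so the profit there is at
   most [2^(-hi)], no more than the profit [2^(-(h-1)i)] of [w]. *)
apply: le_trans (ler_sum _ (fun q _ => profit_le_demand q)) _.
rewrite -mulr_suml ler_pdivrMr ?exprn_gt0//; apply: le_trans (feasible_below fY wY) _.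
rewrite /fg_profit /= mulrC ler_pdivlMr ?exprn_gt0// -exprD ler_weXn2l ?ler1n//.
have := size_bseq w; move=> wh.
rewrite -[X in (_ <= X)%N](subnK (_ : h * size w <= h * h.-1)%N) ?leq_mul2l ?wh ?orbT//.
by rewrite mulnBr leq_add2l leq_mul2r leq_pred orbT.
Qed.

End FractionalSolution.

(** * Size of the instances and the resulting gaps *)

Section Gap.
Variables (R : realType) (h : nat).
Hypothesis h_gt1 : (1 < h)%N.
Local Notation node := ((h.-1).-bseq 'I_(2 ^ h.-1)).
Local Notation I := (fg_instance h R).

Let h_gt0 : (0 < h)%N. Proof. exact: ltnW. Qed.

Lemma fg_gap_ge (s t : nat) : (1 < s)%N -> (t <= 2 ^ (h * s.-1))%N ->
  (t <= #|request I|)%N ->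
  h%:R / (4 * s)%:R <= integrality_gap (P_t (I := I) t) /\
  h%:R / (4 * s)%:R <= integrality_gap (P_t_rank (I := I) t).
Proof.
move=> s1 ts tk; have s0 := ltnW s1.
(* The request of [v_1] alone certifies that the integral optimum is positive. *)
pose r : {set request I} := [set (nil_bseq _ _ : node)].
have fr : feasible r.
  apply/feasibleP; apply: (sparse_fits h_gt1 (s := 1)) => [//|//|q _|w _ _]; first exact: dvd1n.
  rewrite (_ : [set _ in _ | _] = finset.set0) ?cards0//; apply/setP => q; rewrite !inE.
  by case: eqP => // -> /=; apply/negP => /below_size.
have r0 : 0 < \sum_(q in r) profit q by rewrite big_set1 invr_gt0 exprn_gt0.
have x0 (q : request I) : 0 <= half_on_multiples R h s q.
  by rewrite ffunE; case: ifP => _; lra.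
have xP : P_t_rank t (half_on_multiples R h s).
  by split=> [|X]; [exact: half_on_multiples_P_t|exact: half_on_multiples_rank].
have tE : (t <= #|edges I|)%N by rewrite card_fg_edges.
have [] := le_integrality_gap (ltr0Sn R 1) tE (fg_opt_le2 h_gt1) fr r0 x0 xP.
have -> : h%:R / (4 * s)%:R = h%:R / (2 * s)%:R / 2 :> R.
  by rewrite -mulrA -invfM -natrM; congr (_ / _%:R); lia.
have := profit_half_on_multiples R h_gt1 s0.
by rewrite -(ler_pM2r (_ : 0 < 2^-1)) ?invr_gt0// => w gt gr; split; exact: le_trans w _.
Qed.

Lemma card_fg_request :
  #|request I|%:R = \sum_(0 <= j < h) 2 ^+ (h.-1 * j) :> R.
Proof.
rewrite -sum1_card natr_sum (sum_by_level h_gt0); apply: eq_big_nat => j /andP[_ jh].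
rewrite (eq_bigl [pred q : node | suffix [::] q & size q == j]); last first.
  by move=> q; rewrite inE suffix0s.
by rewrite sumr_const (@card_suffix_level _ h_gt0 (nil_bseq _ _)) // subn0 natrX.
Qed.

(** Each of the [h] levels is nonempty. This gives [t <= k] for fixed [t] and large [h]. *)
Lemma card_fg_request_ge : (h <= #|request I|)%N.
Proof.
rewrite -(ler_nat R) card_fg_request.
have -> : h%:R = \sum_(0 <= j < h) 1 :> R by rewrite sumr_const_nat subn0.
by apply: ler_sum => j _; rewrite exprn_ege1 ?ler1n.
Qed.

Lemma card_fg_request_le : #|request I|%:R <= 2 ^+ (h * h.-1) :> R.
Proof.
rewrite card_fg_request mulnC.
have : (0 < h.-1)%N by lia.
move: h.-1 => a a0; elim: (h) => [|m IH]; first by rewrite big_geq ?exprn_ge0.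
rewrite big_nat_recr//=; apply: le_trans (lerD IH (lexx _)) _.
apply: le_trans (_ : 2 ^+ (a * m).+1 <= _); first by rewrite exprS; lra.
by rewrite ler_weXn2l ?ler1n// mulnS; lia.
Qed.

End Gap.

Theorem theorem4 (R : realType) :
  (forall t : nat, (1 <= t)%N ->
     exists alpha : R, 0 < alpha /\
     exists h0 : nat, forall h : nat, (2 <= h)%N -> (h0 <= h)%N ->
       let I := fg_instance h R in
       let k := #|request I| in
       alpha * Num.sqrt (ln k%:R) <= integrality_gap (P_t_rank (I := I) t))
  /\
  (exists alpha : R, 0 < alpha /\
     forall c : R, 0 < c -> c <= 1 ->
     exists h0 : nat, forall h : nat, (2 <= h)%N -> (h0 <= h)%N ->
       let I := fg_instance h R in
       let k := #|request I| in
       let t := Num.truncn (powR k%:R c) in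
       alpha / c <= integrality_gap (P_t (I := I) t) /\
       alpha / c <= integrality_gap (P_t_rank (I := I) t)).
Proof.
split=> [t t1|].
  (* The constant is [1/(4s)] for [s = 2]. *)
  exists (1 / 8); split; first lra.
  (* [h >= t] gives both [t <= h <= k] and [t <= h < 2^h]. *)
  exists t => h h2 th; cbv zeta; set k := #|request _|.
  have hk : (h <= k)%N := card_fg_request_ge R h2.
  have tp : (t <= 2 ^ (h * 2.-1))%N by rewrite muln1 (leq_trans th)// ltnW// ltn_expl.
  have [_] := fg_gap_ge h2 (ltnSn 1) tp (leq_trans th hk).
  apply: le_trans; rewrite -/k natrM.
  (* From [k <= 2^(h(h-1))] and [ln 2 <= 1] follows [ln k <= h(h-1) <= h^2]. *)
  suff : Num.sqrt (ln k%:R) <= h%:R :> R by lra.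
  have k0 : 0 < k%:R :> R by rewrite ltr0n (leq_trans _ hk)// ltnW.
  have -> : h%:R = Num.sqrt (h%:R ^+ 2) :> R by rewrite sqrtr_sqr ger0_norm.
  apply: ler_wsqrtr.
  apply: le_trans (_ : ln (2 ^+ (h * h.-1)) <= _).
    by rewrite ler_ln ?posrE ?exprn_gt0//; exact: card_fg_request_le.
  rewrite lnXn// -(mulr_natr (ln 2)) -natrX.
  have ln2 : ln 2 <= 1 :> R by rewrite (_ : 2 = 1 + 1)// le_ln1Dx//; lra.
  apply: le_trans (ler_wpM2r (ler0n _ _) ln2) _.
  by rewrite mul1r ler_nat -mulnn leq_mul2l leq_pred orbT.
(* The choice of [s] below satisfies [s <= 3ch], so [h/(4s) >= 1/(12c)]. *)
exists (1 / 12); split; first lra.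
(* This threshold exceeds [1/c], so that [ch >= 1]. *)
move=> c c0 c1; exists (Num.truncn c^-1).+1 => h h2 h0 I k t.
have hk : (h <= k)%N := card_fg_request_ge R h2.
have k1 : 1 <= k%:R :> R by rewrite ler1n (leq_trans _ hk)// ltnW.
have ch : 1 <= c * h%:R.
  rewrite mulrC -ler_pdivrMr// div1r ltW//; apply: lt_le_trans (truncnS_gt _) _.
  by rewrite ler_nat.
(* [s - 1] is an integer above [c(h-1)], so [k^c <= 2^(ch(h-1)) <= 2^(h(s-1))]; the second successor
   also gives [s >= 2]. *)
pose s := (Num.truncn (c * h.-1%:R)).+2.
have kc0 : 0 <= powR k%:R c :> R by exact: powR_ge0.
have t_le : t%:R <= powR k%:R c by rewrite truncn_le.
have tk : (t <= k)%N.
  by rewrite -(ler_nat R) (le_trans t_le)// -[leRHS]powRr1// ler_powR.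
have c_s : c * h.-1%:R <= s.-1%:R by rewrite ltW// truncnS_gt.
have ts : (t <= 2 ^ (h * s.-1))%N.
  rewrite -(ler_nat R) (le_trans t_le)// natrX.
  apply: le_trans (_ : powR (2 ^+ (h * h.-1)) c <= _).
    by rewrite ge0_ler_powR ?nnegrE ?exprn_ge0 ?(ltW c0)//; exact: card_fg_request_le.
  rewrite -!powR_mulrn// -powRrM ler_powR ?ler1n// !natrM -mulrA ler_wpM2l//.
  by rewrite mulrC.
(* [s <= c(h-1) + 2], and [ch >= 1] absorbs the 2. *)
have s_le : s%:R <= 3 * (c * h%:R).
  have : s.-2%:R <= c * h.-1%:R by rewrite /= truncn_le ?mulr_ge0// ltW.
  have : c * h.-1%:R <= c * h%:R by rewrite ler_pM2l// ler_nat leq_pred.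
  by rewrite /s /= -[_.+2]addn2 natrD; lra.
have gap_le : 1 / 12 / c <= h%:R / (4 * s)%:R :> R.
  rewrite ler_pdivlMr ?ltr0n// natrM mulrAC ler_pdivrMr//; lra.
by have [] := fg_gap_ge h2 (isT : 1 < s)%N ts tk; split; exact: le_trans gap_le _.
Qed.
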